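(* For $n=3,4,5$, there do not exist rational $5$-designs with $n$ points for the Hermite measure $e^{-t^2}dt/\sqrt{\pi}$ on $(-\infty,\infty)$.
   Context: An $m$-design with $n$ points for a probability measure $w(t)dt$ on an interval $I$ is a set of $n$ pairwise distinct points $x_1,\dots,x_n\in I$ with $\frac1n\sum_i f(x_i)=\int_I f(t)w(t)dt$ for every real polynomial $f$ of degree at most $m$; it is rational if all $x_i\in\mathbb{Q}$. *)

(* Defs.v *)
From mathcomp Require Import all_boot all_order all_algebra.
From mathcomp Require Import all_classical all_reals all_analysis.

Set Implicit Arguments.
Unset Strict Implicit.
Unset Printing Implicit Defensive.

Import Order.TTheory GRing.Theory Num.Theory.
Import numFieldNormedType.Exports.

Local Open Scope classical_set_scope.
Local Open Scope ring_scope.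

(* The integral is extended-real valued, so the equation also forces the
   integral of p * w over I to be finite. *)
Definition is_design (R : realType) (I : interval R) (w : R -> R)
    (m n : nat) (x : 'I_n -> R) : Prop :=
  [/\ injective x,
      forall i, x i \in I &
      forall p : {poly R}, (size p <= m.+1)%N ->
        (n%:R^-1 * \sum_(i < n) p.[x i])%:E =
        (\int[lebesgue_measure]_(t in [set` I]) (p.[t] * w t)%:E)%E].

Definition is_rational_design (R : realType) (I : interval R) (w : R -> R)
    (m n : nat) (x : 'I_n -> R) : Prop :=
  is_design I w m x /\ forall i, exists q : rat, x i = ratr q.

Definition hermite_weight (R : realType) (t : R) : R :=
  expR (- t ^+ 2) / Num.sqrt pi.

(* Main.v *)
Require Import Defs.
From mathcomp Require Import all_boot all_order all_algebra.
From mathcomp Require Import all_classical all_reals all_analysis.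
From mathcomp Require Import measurable_realfun ring lra.

(** Since [p' - 2 X p] times [exp(-t^2)] is the derivative of [p exp(-t^2)], its
    integral vanishes, so its sum over the points of a Hermite design vanishes
    as well. Taking for [p] the powers of [X] determines the power sums of an
    [n]-point 5-design: [P1 = P3 = P5 = 0], [P2 = n/2], [P4 = 3n/4]. On the
    other hand, if [n <= 5] and the odd power sums vanish, Newton's identities
    show that, up to zeros, the points form two opposite pairs [a, -a, b, -b],
    whence [2 P4 <= P2^2]. Together these give [6 n <= n^2], so that even a real
    5-design has at least 6 points. *)

Set Implicit Arguments.
Unset Strict Implicit.
Unset Printing Implicit Defensive.

Import Order.TTheory GRing.Theory Num.Theory.
Import numFieldNormedType.Exports.

Local Open Scope classical_set_scope.
Local Open Scope ring_scope.

Definition power_sum (R : pzSemiRingType) (s : seq R) (k : nat) : R :=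
  \sum_(x <- s) x ^+ k.

Lemma power_sum0 (R : pzSemiRingType) (s : seq R) :
  power_sum s 0 = (size s)%:R.
Proof.
rewrite /power_sum; under eq_bigr do rewrite expr0.
by rewrite big_const_seq count_predT iter_addr addr0.
Qed.

Lemma power_sum_cat_nseq0 (R : pzSemiRingType) (s : seq R) (n k : nat) :
  (0 < k)%N -> power_sum (s ++ nseq n 0) k = power_sum s k.
Proof.
move=> k0; rewrite /power_sum big_cat/= [X in _ + X]big1_seq ?addr0// => x.
by move=> /andP[_ /nseqP[-> _]]; rewrite expr0n gtn_eqF.
Qed.

Lemma prod5_power_sum (R : comPzRingType) (s : seq R) :
  size s = 5 -> power_sum s 1 = 0 ->
  30 * \prod_(x <- s) x =
    6 * power_sum s 5 - 5 * power_sum s 2 * power_sum s 3.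
Proof.
move: s => [|a [|b [|c [|d [|e []]]]]]// _ P1.
have /addr0_eq <- : a + b + c + d + e = 0.
  by rewrite -P1 /power_sum !big_cons big_nil; ring.
by rewrite /power_sum !big_cons !big_nil; ring.
Qed.

Lemma prod4_power_sum (R : comPzRingType) (s : seq R) :
  size s = 4 -> power_sum s 1 = 0 ->
  8 * \prod_(x <- s) x = power_sum s 2 ^+ 2 - 2 * power_sum s 4.
Proof.
move: s => [|a [|b [|c [|d []]]]]// _ P1.
have /addr0_eq <- : a + b + c + d = 0.
  by rewrite -P1 /power_sum !big_cons big_nil; ring.
by rewrite /power_sum !big_cons !big_nil; ring.
Qed.

Lemma odd_power_sums_prod4_ge0 (R : realDomainType) (s : seq R) :
  size s = 4 -> power_sum s 1 = 0 -> power_sum s 3 = 0 ->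
  0 <= \prod_(x <- s) x.
Proof.
move: s => [|a [|b [|c [|d []]]]]// _ P1 P3.
have dE : a + b + c + d = 0.
  by rewrite -P1 /power_sum !big_cons big_nil; ring.
have /eqP : 3 * ((a + b) * (b + c) * (c + a)) = 0.
  rewrite -[RHS]oppr0 -P3 /power_sum !big_cons big_nil -(addr0_eq dE).
  by ring.
rewrite !big_cons big_nil -(addr0_eq dE) {dE P1 P3}.
rewrite !mulf_eq0 pnatr_eq0/= !addr_eq0 => /orP[/orP[]|] /eqP ->.
- by rewrite [leRHS](_ : _ = (b * c) ^+ 2) ?sqr_ge0//; ring.
- by rewrite [leRHS](_ : _ = (a * c) ^+ 2) ?sqr_ge0//; ring.
- by rewrite [leRHS](_ : _ = (a * b) ^+ 2) ?sqr_ge0//; ring.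
Qed.

Lemma power_sum4_le_sqr (R : realDomainType) (s : seq R) :
  (size s <= 5)%N ->
  power_sum s 1 = 0 -> power_sum s 3 = 0 -> power_sum s 5 = 0 ->
  2 * power_sum s 4 <= power_sum s 2 ^+ 2.
Proof.
move=> s5; pose t := s ++ nseq (5 - size s) 0.
have t5 : size t = 5 by rewrite size_cat size_nseq subnKC.
have tE k : (0 < k)%N -> power_sum s k = power_sum t k.
  by move=> k0; rewrite power_sum_cat_nseq0.
rewrite !tE// => P1 P3 P5.
have t0 : 0 \in t.
  have /eqP := prod5_power_sum t5 P1; rewrite P3 P5 !mulr0 subrr mulf_eq0.
  by rewrite pnatr_eq0/= prodf_seq_eq0 => /hasP[x + /eqP x0]; rewrite x0.
have rE k : (0 < k)%N -> power_sum t k = power_sum (rem 0 t) k.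
  move=> k0; rewrite /power_sum (perm_big _ (perm_to_rem t0)) big_cons/=.
  by rewrite expr0n gtn_eqF// add0r.
have r4 : size (rem 0 t) = 4 by rewrite size_rem// t5.
rewrite !rE// in P1 P3 *.
by rewrite -subr_ge0 -prod4_power_sum// mulr_ge0// odd_power_sums_prod4_ge0.
Qed.

Lemma cvg_integral_exhaustion (d : measure_display)
    (T : measurableType d) (R : realType) (mu : {measure set T -> \bar R})
    (D : (set T)^nat) (f : T -> \bar R) :
  (forall n, measurable (D n)) -> (forall x, \forall n \near \oo, D n x) ->
  mu.-integrable setT f ->
  (\int[mu]_(x in D n) f x @[n --> \oo] --> \int[mu]_x f x)%E.
Proof.
move=> mD Dx intf; have mf := measurable_int _ intf.
have mfD n : measurable_fun setT (f \_ (D n)).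
  by apply/(measurable_restrictT _ (mD n)).1; exact: measurable_funS mf.
have fD_cvg : {ae mu, forall x, setT x -> (f \_ (D n)) x @[n --> \oo] --> f x}.
  apply: aeW => x _; apply: cvg_near_cst; near=> n.
  by rewrite patchE ifT// inE; near: n; exact: Dx.
have fD_le : {ae mu, forall x n, setT x ->
    (`|(f \_ (D n)) x| <= (abse \o f) x)%E}.
  by apply: aeW => x n _ /=; rewrite patchE; case: ifPn => // _; rewrite abse0.
under eq_cvg do rewrite integral_mkcond.
by have [] := dominated_convergence measurableT mfD mf fD_cvg
  (integrable_abse intf) fD_le.
Unshelve. all: by end_near. Qed.

Lemma continuous_FTC2T (R : realType) (f F : R -> R) (a b : R) :
  lebesgue_measure.-integrable setT (EFin \o f) -> continuous f ->
  (forall x : R, is_derive x (1 : R) F (f x)) ->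
  F x @[x --> -oo] --> a -> F x @[x --> +oo] --> b ->
  (\int[lebesgue_measure]_x (f x)%:E = (b - a)%:E)%E.
Proof.
move=> intf cf dF Fa Fb; pose c n : R := n.+1%:R.
have cF : continuous F.
  by move=> x; apply/differentiable_continuous/derivable1_diffP; case: (dF x).
have cy : c n @[n --> \oo] --> +oo by rewrite cvg_shiftS; exact: cvgr_idn.
have cNy : - c n @[n --> \oo] --> -oo by exact/cvgNrNy.
pose D n : set (measurableTypeR R) := [set` `[- c n, c n]].
have D_exhausts x : \forall n \near \oo, D n x.
  near=> n; rewrite /D/= in_itv/= -ler_norml.
  by near: n; move/cvgryPge : cy; exact.
have mD n : measurable (D n) by exact: measurable_itv.
have cvg_int := cvg_integral_exhaustion mD D_exhausts intf.
apply: (cvg_unique _ cvg_int) => //.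
have cvgF : (F (c n) - F (- c n))%:E @[n --> \oo] --> (b - a)%:E.
  apply/cvg_EFin; first exact: nearW.
  exact: cvgB (cvg_comp c F cy Fb) (cvg_comp (fun n => - c n) F cNy Fa).
apply: cvg_trans cvgF; apply: near_eq_cvg; apply: nearW => n /=.
rewrite EFinB -(@continuous_FTC2 R f)//.
- by rewrite /c gtrN.
- exact: continuous_subspaceT.
- split=> [x _||]; first by case: (dF x).
  + by apply: cvg_at_right_filter; exact: cF.
  + by apply: cvg_at_left_filter; exact: cF.
- by move=> x _; rewrite derive1E; case: (dF x).
Unshelve. all: by end_near. Qed.

Lemma integrableT_oneDsqrV (R : realType) :
  lebesgue_measure.-integrable setT (fun x : R => (oneDsqr x)^-1%:E).
Proof.
have mf : measurable_fun setT (fun x : R => (oneDsqr x)^-1%:E).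
  apply/measurable_EFinP; apply: continuous_measurable_fun.
  exact: continuous_oneDsqrV.
apply/integrableP; split => //; apply/abse_integralP => //.
rewrite ge0_symfun_integralT//=.
- by rewrite -set_itvcy integral0y_oneDsqr ltry.
- exact: continuous_oneDsqrV.
- by move=> x /=; rewrite /oneDsqr sqrrN.
Qed.

Definition gauss_deriv (R : nzRingType) (p : {poly R}) : {poly R} :=
  p^`() - 2 *: (p * 'X).

Lemma size_gauss_deriv (R : nzRingType) (p : {poly R}) :
  (size (gauss_deriv p) <= (size p).+1)%N.
Proof.
rewrite (leq_trans (size_polyD _ _))// geq_max size_polyN; apply/andP; split.
  have [->|p0] := eqVneq p 0; first by rewrite deriv0 size_poly0.
  exact: leq_trans (ltnW (lt_size_deriv p0)) (leqnSn _).
rewrite (leq_trans (size_scale_leq _ _))// (leq_trans (size_polyMleq _ _))//.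
by rewrite size_polyX addn2.
Qed.

Section horner_gauss.
Variable R : realType.
Implicit Type p : {poly R}.

Lemma continuous_horner_gauss p : continuous (fun x => p.[x] * gauss_fun x).
Proof.
move=> x; apply: continuousM; first exact: continuous_horner.
exact: continuous_gauss_fun.
Qed.

Lemma even_exprn_gauss_le k (x : R) : x ^+ (2 * k) * gauss_fun x <= k`!%:R.
Proof.
case: k => [|k]; first by rewrite muln0 expr0 mul1r gauss_fun_le1.
rewrite /gauss_fun expRN ler_pdivrMr ?expR_gt0// exprM mulrC -ler_pdivrMr.
  by apply: le_trans (expR_ge1Dxn k (sqr_ge0 x)); rewrite lerDr.
by rewrite ltr0n fact_gt0.
Qed.

Lemma norm_exprn_gauss_le k (x : R) :
  `|x ^+ k| * gauss_fun x <= 1 + k`!%:R.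
Proof.
have norm_le : `|x ^+ k| <= 1 + x ^+ (2 * k).
  by rewrite mulnC exprM -real_normK ?num_real//; nra.
apply: le_trans (ler_wpM2r (gauss_fun_ge0 x) norm_le) _.
by rewrite mulrDl mul1r lerD ?gauss_fun_le1 ?even_exprn_gauss_le.
Qed.

Lemma horner_gauss_bounded p :
  exists M, forall x : R, `|p.[x] * gauss_fun x| <= M.
Proof.
exists (\sum_(i < size p) `|p`_i| * (1 + i`!%:R)) => x.
rewrite horner_coef mulr_suml; apply: le_trans (ler_norm_sum _ _ _) _.
apply: ler_sum => i _.
rewrite !normrM (ger0_norm (gauss_fun_ge0 x)) -mulrA; apply: ler_wpM2l => //.
exact: norm_exprn_gauss_le.
Qed.

Lemma cvgy_horner_gauss p : p.[x] * gauss_fun x @[x --> +oo] --> (0 : R).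
Proof.
have [M pM] := horner_gauss_bounded (p * 'X).
apply/norm_cvg0P.
apply: (@squeeze_cvgr _ _ _ _ (fun=> 0) (fun x => M * x^-1)).
- near=> x; have x0 : 0 < x by near: x; exact: nbhs_pinfty_gt.
  rewrite normr_ge0/= ler_pdivlMr//.
  by have := pM x; rewrite hornerMX mulrAC normrM (gtr0_norm x0).
- exact: cvg_cst.
- rewrite -[X in _ --> X](mulr0 M); apply: cvgMl_tmp.
  by apply/gtr0_cvgV0; [exact: nbhs_pinfty_gt|exact: cvg_id].
Unshelve. all: by end_near. Qed.

Lemma cvgNy_horner_gauss p : p.[x] * gauss_fun x @[x --> -oo] --> (0 : R).
Proof.
apply/cvgNy_compNP; apply: cvg_trans (cvgy_horner_gauss (p \Po - 'X)).
apply: near_eq_cvg; apply: nearW => x /=.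
by rewrite horner_comp !hornerE /gauss_fun sqrrN.
Qed.

Lemma integrableT_horner_gauss p :
  lebesgue_measure.-integrable setT (EFin \o (fun x => p.[x] * gauss_fun x)).
Proof.
pose q := p * (1 + 'X^2).
have qE x : p.[x] * gauss_fun x = (q.[x] * gauss_fun x) * (oneDsqr x)^-1.
  by rewrite /q !hornerE mulrAC mulfK// gt_eqF// ltr_pwDl ?sqr_ge0.
have q_bounded : [bounded q.[x] * gauss_fun x | x in [set: R]].
  have [M qM] := horner_gauss_bounded q.
  exists M; split; first exact: num_real.
  by move=> y /ltW My x _; apply: le_trans My.
have mq : measurable_fun [set: measurableTypeR R]
    (fun x => q.[x] * gauss_fun x).
  by apply: continuous_measurable_fun; exact: continuous_horner_gauss.
have := integrableMr measurableT mq q_bounded (integrableT_oneDsqrV R).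
by apply: eq_integrable => // x _ /=; rewrite qE EFinM.
Qed.

Lemma is_derive_horner_gauss p (x : R) :
  is_derive x (1 : R) (fun t => p.[t] * gauss_fun t)
    ((gauss_deriv p).[x] * gauss_fun x).
Proof.
have dg : is_derive x (1 : R) gauss_fun (gauss_fun x * - (2 * x)).
  apply: (@is_derive1_comp R expR (fun t => - t ^+ 2)).
  by apply: is_derive_eq; rewrite /GRing.scale/=; ring.
apply: is_derive_eq.
by rewrite /GRing.scale/= /gauss_deriv !hornerE/=; ring.
Qed.

Lemma integral_gauss_deriv p :
  (\int[lebesgue_measure]_x ((gauss_deriv p).[x] * gauss_fun x)%:E = 0)%E.
Proof.
rewrite (continuous_FTC2T (integrableT_horner_gauss _)
  (continuous_horner_gauss (p := _)) (is_derive_horner_gauss p)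
  (cvgNy_horner_gauss p) (cvgy_horner_gauss p)).
by rewrite subrr.
Qed.

Lemma integral_gauss_deriv_hermite_weight p :
  (\int[lebesgue_measure]_x ((gauss_deriv p).[x] * hermite_weight x)%:E = 0)%E.
Proof.
under eq_integral do rewrite /hermite_weight mulrA EFinM.
rewrite integralZr ?integral_gauss_deriv ?mul0e//.
exact: integrableT_horner_gauss.
Qed.

End horner_gauss.

Section hermite_design.
Variables (R : realType) (m n : nat) (x : 'I_n -> R).
Hypothesis x_design : is_design `]-oo, +oo[ (@hermite_weight R) m x.

Lemma hermite_design_sum_gauss_deriv (p : {poly R}) :
  (size p <= m)%N -> \sum_(i < n) (gauss_deriv p).[x i] = 0.
Proof.
case: x_design => _ _ design_int pm.
have /design_int : (size (gauss_deriv p) <= m.+1)%N.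
  exact: leq_trans (size_gauss_deriv p) _.
rewrite set_itvNyy integral_gauss_deriv_hermite_weight => -[] /eqP.
rewrite mulf_eq0 invr_eq0 pnatr_eq0 => /orP[/eqP n0|/eqP//].
by rewrite big1// => i _; have := ltn_ord i; rewrite [X in (_ < X)%N]n0.
Qed.

Lemma hermite_design_power_sumS (k : nat) :
  (k < m)%N ->
  2 * power_sum (codom x) k.+1 = k%:R * power_sum (codom x) k.-1.
Proof.
move=> km; have := @hermite_design_sum_gauss_deriv 'X^k.
rewrite size_polyXn => /(_ km); rewrite /power_sum !big_image/= !mulr_sumr.
move=> sum0; apply/esym/eqP; rewrite -subr_eq0 -sumrB -[X in _ == X]sum0.
apply/eqP/eq_bigr => i _; rewrite /gauss_deriv derivXn -exprSr !hornerE.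
by rewrite hornerMn !hornerXn mulr_natl.
Qed.

Lemma hermite_design_size_ge6 : (5 <= m)%N -> (0 < n)%N -> (6 <= n)%N.
Proof.
move=> m5 n0; pose P := power_sum (codom x).
have PS k : (k < 5)%N -> P k.+1 = k%:R / 2 * P k.-1.
  move=> k5; have := hermite_design_power_sumS (leq_trans k5 m5).
  by rewrite -/P => PkE; lra.
have P0 : P 0 = n%:R by rewrite /P power_sum0 size_codom card_ord.
have P1 : P 1 = 0 by rewrite PS// !mul0r.
have P2 : P 2 = n%:R / 2 by rewrite PS// P0; lra.
have P3 : P 3 = 0 by rewrite PS// P1 mulr0.
have P4 : P 4 = 3 / 4 * n%:R by rewrite PS// P2; lra.
have P5 : P 5 = 0 by rewrite PS// P3 mulr0.
rewrite leqNgt ltnS; apply/negP => n5.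
have := @power_sum4_le_sqr _ (codom x).
rewrite size_codom card_ord => /(_ n5 P1 P3 P5).
rewrite -/P P2 P4 leNgt => /negP; apply.
have := n0; rewrite -(ltr0n R) => n_gt0.
by move: n5; rewrite -(ler_nat R) => n_le5; nra.
Qed.

End hermite_design.

Theorem theorem2p22 (R : realType) (n : nat)
    (hn : n = 3%N \/ n = 4%N \/ n = 5%N) :
  ~ exists x : 'I_n -> R,
      is_rational_design `]-oo, +oo[ (@hermite_weight R) 5%N x.
Proof.
move=> [x [x_design _]]; have := hermite_design_size_ge6 x_design (leqnn 5).
by case: hn => [|[|]] -> /(_ isT).
Qed.
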